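(* Let $c_0$ be a proper $4$-colouring of the plane, let $\mu$ be a left-invariant finitely additive probability measure on $S_4\times E(2)$, and let $p_d$ be the associated monochromaticity probabilities (see context). Then $$p_{\frac{\sqrt6+\sqrt2}{2}}\ge\frac{13}{75}.$$
   Context: Identify the plane with $\mathbb C$. A proper $4$-colouring of the plane is a map $c_0:\mathbb C\to\{1,2,3,4\}$ such that no two points at distance $1$ have the same colour. Let $S_4$ be the group of permutations of the colours and $E(2)$ the group of Euclidean isometries of the plane. The group $S_4\times E(2)$ is amenable, so there is a finitely additive probability measure $\mu$ defined on all subsets of $S_4\times E(2)$ which is left-invariant, i.e. $\mu(gE)=\mu(E)$ for all $g\in S_4\times E(2)$ and $E\subseteq S_4\times E(2)$. For $(\sigma,T)\in S_4\times E(2)$ consider the (random) colouring $c=\sigma\circ c_0\circ T^{-1}$. For $d\ge 0$, $p_d$ denotes the probability that two points $A,B$ at distance $d$ get the same colour: $p_d=\mu(\{(\sigma,T): c(A)=c(B)\})$; by left-invariance this does not depend on the choice of $A,B$ with $|AB|=d$. The existence of $c_0$ is a standing assumption, and $c_0,\mu$ are arbitrary but fixed. *)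

(* Defs.v *)
From HB Require Import structures.
From mathcomp Require Import all_boot all_order all_algebra all_fingroup.
From mathcomp Require Import complex.
From mathcomp Require Import boolp classical_sets reals.

Set Implicit Arguments.
Unset Strict Implicit.
Unset Printing Implicit Defensive.

Import Order.TTheory GRing.Theory Num.Theory.

Local Open Scope classical_set_scope.
Local Open Scope ring_scope.

(* On R[i] the norm is R[i]-valued, so real distances are compared to it
   through the embedding _%:C. *)
Definition proper4 (R : realType) (c : R[i] -> 'I_4) : Prop :=
  forall x y : R[i], `|x - y| = 1 -> c x <> c y.

Record plane_isometry (R : realType) := Isometry {
  iso_fun :> R[i] -> R[i];
  iso_inv : R[i] -> R[i];
  iso_funK : cancel iso_fun iso_inv;
  iso_invK : cancel iso_inv iso_fun;
  iso_dist : forall x y : R[i], `|iso_fun x - iso_fun y| = `|x - y| }.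

Lemma iso_comp_dist (R : realType) (S T : plane_isometry R) (x y : R[i]) :
  `|(S \o T) x - (S \o T) y| = `|x - y|.
Proof. by rewrite /= !iso_dist. Qed.

Definition iso_comp (R : realType) (S T : plane_isometry R) : plane_isometry R :=
  Isometry (can_comp (iso_funK S) (iso_funK T))
           (can_comp (iso_invK T) (iso_invK S))
           (iso_comp_dist S T).

Definition S4E2 (R : realType) : Type := ('S_4 * plane_isometry R)%type.

(* Both components are composed as functions, (s, S)(t, T) = (s o t, S o T);
   the product of permutations in perm.v is diagrammatic, whence the swap. *)
Definition S4E2_mul (R : realType) (g h : S4E2 R) : S4E2 R :=
  ((h.1 * g.1)%g, iso_comp g.2 h.2).

Record fin_add_prob (R : realType) (G : Type) := FinAddProb {
  fap_fun :> set G -> R;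
  fap_ge0 : forall E : set G, 0 <= fap_fun E;
  fap_setT : fap_fun setT = 1;
  fap_setU : forall E F : set G,
    E `&` F = set0 -> fap_fun (E `|` F) = fap_fun E + fap_fun F }.

Definition left_invariant (R : realType) (mu : fin_add_prob R (S4E2 R)) : Prop :=
  forall (g : S4E2 R) (E : set (S4E2 R)), mu (S4E2_mul g @` E) = mu E.

Definition recolour (R : realType) (c0 : R[i] -> 'I_4) (g : S4E2 R) :
    R[i] -> 'I_4 :=
  g.1 \o c0 \o iso_inv g.2.

Definition mono_prob (R : realType) (c0 : R[i] -> 'I_4)
    (mu : fin_add_prob R (S4E2 R)) (A B : R[i]) : R :=
  mu [set g | recolour c0 g A = recolour c0 g B].

(* Main.v *)
(* Let p(x) be the monochromaticity probability at squared distance x, and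
   d, s, t its values at 2 + sqrt 3, 2 and 2 - sqrt 3.  Among the points at
   distance sqrt 2 from O there are two at distance 1, so s <= 1/2.  In a proper
   4-colouring of the sum of two unit triangles at right angles, 9 points forming
   a 3 x 3 rook graph, at least 6 of the 18 non-adjacent pairs are monochromatic;
   these pairs realise t, s and d six times each, so t + s + d >= 1.  In a proper
   4-colouring of a regular 12-gon of radius 1 together with its centre, three
   times the number of monochromatic sides is at most five times the number of
   monochromatic chords of angle 150 degrees, so 3 t <= 5 d.  Hence
   d >= 3/16 > 13/75.  The two pointwise inequalities are checked by exhaustive
   search. *)
Require Import Defs.
From mathcomp Require Import all_boot all_order all_algebra all_fingroup.
From mathcomp Require Import complex.
From mathcomp Require Import boolp classical_sets reals.
From mathcomp Require Import ring lra.

Import Order.TTheory GRing.Theory Num.Theory.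

Local Open Scope ring_scope.

(** * Finitely additive probabilities *)

Section FinAddProb.
Local Open Scope classical_set_scope.
Context {R : realType} {G : Type} (mu : fin_add_prob R G).

Lemma fap_set0 : mu set0 = 0.
Proof.
have := fap_setU mu (setI0 set0); rewrite setU0 => h.
by apply: (addrI (mu set0)); rewrite -h addr0.
Qed.

Lemma fap_split (S E : set G) : mu S = mu (S `&` E) + mu (S `&` ~` E).
Proof.
rewrite -fap_setU; first by rewrite -setIUr setUCr setIT.
by rewrite setIACA setICr setI0.
Qed.

Lemma fap_le (E F : set G) : E `<=` F -> mu E <= mu F.
Proof. by move=> EF; rewrite (fap_split F E) (setIidr EF) lerDl fap_ge0. Qed.

(** Monotonicity of expectation without integrals: induct on [l], splitting [S] along [E i]. Inside
    [E i] the bound left to prove drops to [K - w i]; outside it stays [K]. The induction needs the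
    form relative to [S]. *)
Lemma fap_expectation_ge_in (I : Type) (l : seq I) (w : I -> R)
    (E : I -> set G) (S : set G) (K : R) :
  (forall g, S g -> K <= \sum_(i <- l) w i * `[< E i g >]%:R) ->
  K * mu S <= \sum_(i <- l) w i * mu (S `&` E i).
Proof.
elim: l S K => [|i l IH] S K h.
  (* With no events left the hypothesis says [K <= 0], unless [S] is empty. *)
  rewrite big_nil; have [->|/set0P[g /h]] := eqVneq S set0.
    by rewrite fap_set0 mulr0.
  by rewrite big_nil => K0; rewrite mulr_le0_ge0 ?fap_ge0.
have hin : (K - w i) * mu (S `&` E i)
    <= \sum_(j <- l) w j * mu (S `&` E i `&` E j).
  apply: IH => g [Sg Eg]; rewrite lerBlDl (le_trans (h g Sg)) //.
  by rewrite big_cons asboolT // mulr1.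
have hout : K * mu (S `&` ~` E i)
    <= \sum_(j <- l) w j * mu (S `&` ~` E i `&` E j).
  apply: IH => g [Sg Eg]; rewrite (le_trans (h g Sg)) //.
  by rewrite big_cons asboolF // mulr0 add0r.
rewrite big_cons (fap_split S (E i)).
have -> : \sum_(j <- l) w j * mu (S `&` E j) =
    \sum_(j <- l) w j * mu (S `&` E i `&` E j) +
    \sum_(j <- l) w j * mu (S `&` ~` E i `&` E j).
  rewrite -big_split; apply: eq_bigr => j _ /=.
  by rewrite (fap_split (S `&` E j) (E i)) mulrDr ![S `&` E j `&` _]setIAC.
lra.
Qed.

Lemma fap_expectation_ge (I : Type) (l : seq I) (w : I -> R)
    (E : I -> set G) (K : R) :
  (forall g, K <= \sum_(i <- l) w i * `[< E i g >]%:R) ->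
  K <= \sum_(i <- l) w i * mu (E i).
Proof.
move=> h; have := @fap_expectation_ge_in _ l w E setT K (fun g _ => h g).
by rewrite fap_setT mulr1; under eq_bigr do rewrite setTI.
Qed.

End FinAddProb.

(** * Invariance of monochromaticity probabilities under isometries *)

Section Monochromatic.
Local Open Scope classical_set_scope.
Context {R : realType} (c0 : R[i] -> 'I_4) (mu : fin_add_prob R (S4E2 R)).

Lemma recolour_proper (g : S4E2 R) : proper4 c0 -> proper4 (recolour c0 g).
Proof.
move=> hc x y xy /perm_inj; apply: hc.
by rewrite -(iso_dist g.2) !iso_invK.
Qed.

Lemma mono_prob_iso_le (T : plane_isometry R) (A B : R[i]) :
  left_invariant mu -> mono_prob c0 mu A B <= mono_prob c0 mu (T A) (T B).
Proof.
(* Left translation by [(1, T)] precomposes the colouring with the inverse of [T], so it carries the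
   event for [A], [B] into the one for [T A], [T B]. *)
move=> hmu; rewrite /mono_prob -(hmu (1%g, T)); apply: fap_le.
move=> _ [h hh <-]; rewrite /recolour /= !iso_funK !permM.
by move: hh; rewrite /recolour /= => ->.
Qed.

Lemma exists_similarity_iso (u a b : R[i]) : `|u| = 1 ->
  exists T : plane_isometry R, forall z, T z = u * (z - a) + b.
Proof.
move=> hu; have u0 : u != 0 by rewrite -normr_eq0 hu oner_neq0.
have fK : cancel (fun z => u * (z - a) + b) (fun z => (z - b) / u + a).
  by move=> z; rewrite addrK mulrAC divff // mul1r subrK.
have gK : cancel (fun z => (z - b) / u + a) (fun z => u * (z - a) + b).
  by move=> z; rewrite addrK mulrC divfK // subrK.
have fD x y : `|u * (x - a) + b - (u * (y - a) + b)| = `|x - y|.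
  by rewrite (_ : _ - _ = u * (x - y)) ?normrM ?hu ?mul1r //; ring.
by exists (Isometry fK gK fD).
Qed.

Lemma mono_prob_dist (A B C D : R[i]) : left_invariant mu ->
  `|A - B| = `|C - D| -> mono_prob c0 mu A B = mono_prob c0 mu C D.
Proof.
move=> hmu.
suff le (X Y Z W : R[i]) : `|X - Y| = `|Z - W| ->
    mono_prob c0 mu X Y <= mono_prob c0 mu Z W.
  by move=> h; apply: le_anti; rewrite !le // h.
move=> h; have [XY|XY] := eqVneq X Y.
  move: h; rewrite XY subrr normr0 => /esym/eqP.
  rewrite normr_eq0 subr_eq0 => /eqP ->.
  apply: fap_le => g _ //=.
have XY0 : X - Y != 0 by rewrite subr_eq0.
(* The quotient is the rotation taking [Y - X] to [W - Z]. *)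
have hu : `|(W - Z) / (Y - X)| = 1.
  by rewrite normf_div distrC -h distrC divff // normr_eq0 -opprB oppr_eq0.
have [T TE] := exists_similarity_iso _ X Z hu.
have := mono_prob_iso_le T X Y hmu; rewrite !TE subrr mulr0 add0r.
by rewrite divfK ?subrK // -opprB oppr_eq0.
Qed.

End Monochromatic.

(** * Exhaustive search over proper colourings *)

Section ColouringSearch.
Context {T : Type} (adj : rel T) (w : T -> T -> int) (n : nat).

(** [s] holds the points already placed, so pairs are grouped by the step at which [search] scores
    them. *)
Fixpoint pairs_onto (V s : seq T) : seq (T * T) :=
  if V is p :: V' then [seq (p, q) | q <- s] ++ pairs_onto V' (p :: s)
  else [::].

Definition gain (s : seq (T * nat)) (p : T) (c : nat) : int :=
  foldr (fun q a => if q.2 == c then w p q.1 + a else a) 0 s.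

(* Colours are labelled by order of first use, so that each partition into
   colour classes is met once; k labels are in use.  The conflict test is an
   [if] because vm_compute evaluates both arguments of [||]. *)
Fixpoint search (V : seq T) (s : seq (T * nat)) (k : nat) (K : int) : bool :=
  if V is p :: V' then
    all (fun c => if has (fun q => adj p q.1 && (q.2 == c)) s then true
          else search V' ((p, c) :: s) (maxn k c.+1) (K - gain s p c))
        (iota 0 (minn k.+1 n))
  else K <= 0.

Variable f : T -> 'I_n.
Hypothesis f_proper : forall p q, adj p q -> f p <> f q.

Let label (cs : seq 'I_n) (s : seq T) := [seq (q, index (f q) cs) | q <- s].

Lemma gain_label (cs : seq 'I_n) (s : seq T) (p : T) :
  f p \in cs -> all (fun q => f q \in cs) s ->
  gain (label cs s) p (index (f p) cs) =
  \sum_(q <- s) w p q * (f p == f q)%:R.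
Proof.
move=> pcs; elim: s => [|q s IH] /=; first by rewrite big_nil.
case/andP=> qcs /IH; rewrite big_cons /gain /= => ->.
have -> : (index (f q) cs == index (f p) cs) = (f p == f q).
  apply/eqP/eqP => [|-> //] h.
  by rewrite -[LHS](nth_index (f p) pcs) -h nth_index.
by case: eqP; rewrite ?mulr1 // mulr0 add0r.
Qed.

(** [K] is the bound still owed by the pairs with a point in [V]. As [cs] lists the colours in order
    of first use, indices in [cs] label the branch of the search that [f] follows. *)
Lemma search_sound_from (V s : seq T) (cs : seq 'I_n) (K : int) :
  uniq cs -> all (fun q => f q \in cs) s ->
  search V (label cs s) (size cs) K ->
  K <= \sum_(pq <- pairs_onto V s) w pq.1 pq.2 * (f pq.1 == f pq.2)%:R.
Proof.
elim: V s cs K => [|p V IH] s cs K ucs scs /=; first by rewrite big_nil.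
(* A new colour goes at the end, so labels already given do not change. *)
pose ds := if f p \in cs then cs else rcons cs (f p).
have uds : uniq ds by rewrite /ds; case: ifP => // h; rewrite rcons_uniq h.
have pds : f p \in ds.
  by rewrite /ds; case: ifP => // _; rewrite mem_rcons mem_head.
have sds : all (fun q => f q \in ds) s.
  apply: sub_all scs => q qcs; rewrite /ds; case: ifP => // _.
  by rewrite mem_rcons in_cons qcs orbT.
have -> : label cs s = label ds s.
  elim: s scs {sds} => //= q s IHs /andP[qcs /IHs ->]; congr ((_, _) :: _).
  by rewrite /ds; case: ifP => // _; rewrite -cats1 index_cat qcs.
have szds : size ds = maxn (size cs) (index (f p) ds).+1.
  rewrite /ds; case: ifP => h.
    by apply/esym/maxn_idPl; rewrite index_mem.
  by rewrite -cats1 index_cat h /= eqxx addn0 size_cat addn1 maxnC (maxn_idPl _).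
move=> /allP/(_ (index (f p) ds)).
have -> : index (f p) ds \in iota 0 (minn (size cs).+1 n).
  rewrite mem_iota leq0n add0n andTb leq_min; apply/andP; split.
    have : (index (f p) ds < size ds)%N by rewrite index_mem.
    by move/leq_trans; apply; rewrite /ds; case: ifP => // _; rewrite size_rcons.
  have : (index (f p) ds < size ds)%N by rewrite index_mem.
  move/leq_trans; apply.
  by rewrite -(card_uniqP uds) -[leqRHS](card_ord n) max_card.
have -> : has (fun q => adj p q.1 && (q.2 == index (f p) ds)) (label ds s)
    = false.
  elim: s sds {scs} => //= q s IHs /andP[qds /IHs ->]; rewrite orbF.
  apply/negP => /andP[/f_proper npq /eqP h]; case: npq.
  by rewrite -(nth_index (f p) pds) -h nth_index.
move=> /(_ isT) /=.
rewrite -szds => /(IH (p :: s) ds _ uds); rewrite /= pds sds => /(_ isT).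
rewrite gain_label // big_cat big_map /= => h.
by rewrite -lerBlDl.
Qed.

Lemma search_sound (V : seq T) (K : int) : search V [::] 0 K ->
  K <= \sum_(pq <- pairs_onto V [::]) w pq.1 pq.2 * (f pq.1 == f pq.2)%:R.
Proof. exact: (@search_sound_from V [::] [::]). Qed.

End ColouringSearch.

(* [(x, y, z, w)] stands for x + y om + i (z + w om), with om = exp(i pi/3);
   these are the elements of Z[exp(i pi/6)], and the pair (a, b) of
   [sq_dist p q] stands for the squared distance a + b sqrt 3. *)
Definition zpt : Type := (int * int * int * int)%type.

Definition sq_dist (p q : zpt) : int * int :=
  let: (x, y, z, w) := p in let: (x', y', z', w') := q in
  let: (x, y, z, w) := (x - x', y - y', z - z', w - w') in
  (x * x + x * y + y * y + (z * z + z * w + w * w), y * z - x * w).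

Definition unit_apart (p q : zpt) : bool := sq_dist p q == (1, 0).

Definition weight (ws : seq ((int * int) * int)) (d : int * int) : int :=
  foldr (fun e a => if e.1 == d then e.2 + a else a) 0 ws.

Definition dists (V : seq zpt) : seq (int * int) :=
  [seq sq_dist pq.1 pq.2 | pq <- pairs_onto V [::]].

(** * From point configurations to inequalities between probabilities *)

Section Configurations.
Local Open Scope classical_set_scope.
Context {R : realType} (c0 : R[i] -> 'I_4) (mu : fin_add_prob R (S4E2 R)).
Hypotheses (hc0 : proper4 c0) (hmu : left_invariant mu).

Definition zpt_val (p : zpt) : R[i] :=
  let: (x, y, z, w) := p in
  ((x%:~R + y%:~R / 2 - w%:~R * Num.sqrt 3 / 2)
    +i* (y%:~R * Num.sqrt 3 / 2 + z%:~R + w%:~R / 2))%C.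

Definition sq_val (d : int * int) : R := d.1%:~R + d.2%:~R * Num.sqrt 3.

(* The argument is the squared distance. *)
Definition prob_at (x : R) : R := mono_prob c0 mu 0 (Num.sqrt x)%:C%C.

Lemma normc_sqrt (z : R[i]) :
  `|z| = (Num.sqrt (complex.Re z ^+ 2 + complex.Im z ^+ 2))%:C%C.
Proof. by case: z => a b; rewrite normc_def. Qed.

Lemma mono_probE (A B : R[i]) (x : R) : `|A - B| = (Num.sqrt x)%:C%C ->
  mono_prob c0 mu A B = prob_at x.
Proof.
move=> h; apply: mono_prob_dist => //.
rewrite h sub0r normrN normc_sqrt /= expr0n addr0.
by rewrite sqrtr_sqr ger0_norm // sqrtr_ge0.
Qed.

Lemma zpt_dist (p q : zpt) :
  `|zpt_val p - zpt_val q| = (Num.sqrt (sq_val (sq_dist p q)))%:C%C.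
Proof.
case: p => [[[x y] z] w]; case: q => [[[x' y'] z'] w'].
rewrite normc_sqrt; congr (Num.sqrt _)%:C%C; rewrite /= /sq_val /=.
set s := Num.sqrt 3; have s2 : s ^+ 2 - 3 = 0 by rewrite sqr_sqrtr ?subrr //.
apply/eqP; rewrite -subr_eq0; apply/eqP.
set dy : R := y%:~R - y'%:~R; set dw : R := w%:~R - w'%:~R.
(* As polynomials in [s], the two sides differ only in the [s ^+ 2] terms, which come from [y] and
   [w]. *)
transitivity ((dy ^+ 2 + dw ^+ 2) / 4 * (s ^+ 2 - 3)); last by rewrite s2 mulr0.
by rewrite /dy /dw; field.
Qed.

Lemma prob_at2_le_half : prob_at 2 <= 2^-1.
Proof.
(* The height of the isosceles triangle with legs sqrt 2 and base 1. *)
pose x : R := Num.sqrt 7 / 2.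
have x2 : x ^+ 2 = 7 / 4 by rewrite /x expr_div_n sqr_sqrtr //; field.
pose A := (x +i* 2^-1)%C; pose B := (x -i* 2^-1)%C.
have AB : `|A - B| = 1.
  by rewrite normc_sqrt /= (_ : _ + _ = 1) ?sqrtr1 //; field.
have pA : mono_prob c0 mu 0 A = prob_at 2.
  apply: mono_probE; rewrite sub0r normrN normc_sqrt /= x2.
  by congr (Num.sqrt _)%:C%C; field.
have pB : mono_prob c0 mu 0 B = prob_at 2.
  apply: mono_probE; rewrite sub0r normrN normc_sqrt /= x2.
  by congr (Num.sqrt _)%:C%C; field.
suff : prob_at 2 + prob_at 2 <= 1 by lra.
rewrite -{1}pA -pB -(fap_setT mu) -fap_setU; first exact: fap_le.
apply/seteqP; split=> // g [/= gA gB].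
by apply: (recolour_proper c0 g hc0 _ _ AB); rewrite -gA -gB.
Qed.

Lemma sum_weight (ws : seq ((int * int) * int)) (l : seq (int * int))
    (F : int * int -> R) :
  \sum_(d <- l) (weight ws d)%:~R * F d =
  \sum_(e <- ws) (e.2 * (count_mem e.1 l)%:Z)%:~R * F e.1.
Proof.
elim: ws => [|e ws IH]; first by rewrite big_nil big1 // => d _; rewrite mul0r.
rewrite big_cons -IH; elim: l {IH} => [|d l IH].
  by rewrite !big_nil /= mulr0 mul0r addr0.
rewrite !big_cons IH /= [d == _]eq_sym; case: eqP => [->|_] /=; last first.
  by rewrite add0n addrCA.
rewrite PoszD; ring.
Qed.

(** The search bounds every proper colouring; averaging over [mu] turns each indicator into
    [prob_at] of its squared distance. *)
Lemma configuration_bound (V : seq zpt) (ws : seq ((int * int) * int))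
    (K : int) (N : nat) :
  search unit_apart (fun p q => weight ws (sq_dist p q)) 4 V [::] 0 K ->
  all (fun e => count_mem e.1 (dists V) == N) ws ->
  K%:~R <= N%:R * \sum_(e <- ws) e.2%:~R * prob_at (sq_val e.1).
Proof.
move=> hK hN.
have -> : N%:R * \sum_(e <- ws) e.2%:~R * prob_at (sq_val e.1) =
    \sum_(e <- ws) (e.2 * (count_mem e.1 (dists V))%:Z)%:~R
                   * prob_at (sq_val e.1).
  elim: ws hN {hK} => [|e ws IH] /=; first by rewrite !big_nil mulr0.
  case/andP=> /eqP he /IH {}IH; rewrite !big_cons mulrDr IH he; ring.
rewrite -(sum_weight ws (dists V) (fun d => prob_at (sq_val d))) big_map.
under eq_bigr => pq _ do
  rewrite -(mono_probE _ _ _ (zpt_dist pq.1 pq.2)).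
apply: fap_expectation_ge => g.
have /(search_sound _ _ _ (recolour c0 g \o zpt_val)) h := hK.
apply: le_trans (_ : (\sum_(pq <- pairs_onto V [::])
  weight ws (sq_dist pq.1 pq.2) * (recolour c0 g (zpt_val pq.1) ==
    recolour c0 g (zpt_val pq.2))%:R)%:~R <= _).
  rewrite ler_int; apply: h => p q /eqP pq; apply: recolour_proper hc0 _ _ _.
  by rewrite zpt_dist pq /sq_val /= mul0r addr0 sqrtr1.
rewrite raddf_sum; apply: ler_sum => pq _ /=; rewrite intrM.
by case: eqP => eq_col; [rewrite asboolT | rewrite asboolF].
Qed.

End Configurations.

(* Unit vectors at multiples of 60 degrees first, then the odd multiples of 30
   degrees: this order detects conflicts early. *)
Definition dodecagon : seq zpt :=
  [:: (0, 0, 0, 0); (1, 0, 0, 0); (0, 1, 0, 0); (-1, 1, 0, 0); (-1, 0, 0, 0);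
      (0, -1, 0, 0); (1, -1, 0, 0); (0, 0, 1, 0); (0, 0, 0, 1); (0, 0, -1, 1);
      (0, 0, -1, 0); (0, 0, 0, -1); (0, 0, 1, -1)].

(* The Minkowski sum of the triangles {0, 1, om} and {0, i, i om}. *)
Definition triangle_product : seq zpt :=
  [:: (0, 0, 0, 0); (1, 0, 0, 0); (0, 1, 0, 0); (0, 0, 1, 0); (1, 0, 1, 0);
      (0, 1, 1, 0); (0, 0, 0, 1); (1, 0, 0, 1); (0, 1, 0, 1)].

Lemma dodecagon_bound {R : realType} (c0 : R[i] -> 'I_4)
    (mu : fin_add_prob R (S4E2 R)) : proper4 c0 -> left_invariant mu ->
  3 * prob_at c0 mu (sq_val (2, -1)) <= 5 * prob_at c0 mu (sq_val (2, 1)).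
Proof.
move=> hc0 hmu; pose ws : seq (int * int * int) := [:: ((2, 1), 5); ((2, -1), -3)].
have : 0 <= 12%:R * \sum_(e <- ws) e.2%:~R * prob_at c0 mu (sq_val e.1).
  by apply: (configuration_bound _ _ hc0 hmu dodecagon _ 0); vm_compute.
rewrite /ws !big_cons !big_nil /=; lra.
Qed.

(** The bound 6 is the count for 9 points in four classes of sizes 3, 2, 2, 2. *)
Lemma triangle_product_bound {R : realType} (c0 : R[i] -> 'I_4)
    (mu : fin_add_prob R (S4E2 R)) : proper4 c0 -> left_invariant mu ->
  1 <= prob_at c0 mu (sq_val (2, -1)) + prob_at c0 mu 2
     + prob_at c0 mu (sq_val (2, 1)).
Proof.
move=> hc0 hmu.
pose ws : seq (int * int * int) := [:: ((2, -1), 1); ((2, 0), 1); ((2, 1), 1)].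
have : 6 <= 6%:R * \sum_(e <- ws) e.2%:~R * prob_at c0 mu (sq_val e.1).
  by apply: (configuration_bound _ _ hc0 hmu triangle_product _ 6); vm_compute.
have e2 : sq_val (2, 0) = 2 :> R by rewrite /sq_val /= mul0r addr0.
rewrite /ws !big_cons !big_nil /= e2; lra.
Qed.

Theorem mainTheorem3 (R : realType) (c0 : R[i] -> 'I_4)
    (mu : fin_add_prob R (S4E2 R)) (hc0 : proper4 c0)
    (hmu : left_invariant mu) (A B : R[i])
    (hAB : `|A - B| = ((Num.sqrt 6 + Num.sqrt 2) / 2)%:C%C) :
  13 / 75 <= mono_prob c0 mu A B.
Proof.
have hd := dodecagon_bound c0 mu hc0 hmu.
have ht := triangle_product_bound c0 mu hc0 hmu.
have hs := prob_at2_le_half c0 mu hc0 hmu.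
have s3 : Num.sqrt 3 ^+ 2 = 3 :> R by rewrite sqr_sqrtr.
have s2 : Num.sqrt 2 ^+ 2 = 2 :> R by rewrite sqr_sqrtr.
have -> : mono_prob c0 mu A B = prob_at c0 mu (sq_val (2, 1)).
  apply: mono_probE => //; rewrite hAB; congr _%:C%C.
  (* The length is nonnegative, so it suffices that its square is 2 + sqrt 3. *)
  rewrite -[LHS]ger0_norm ?divr_ge0 ?addr_ge0 ?sqrtr_ge0 // -sqrtr_sqr.
  congr (Num.sqrt _); rewrite /sq_val /= mul1r.
  have -> : Num.sqrt 6 = Num.sqrt 2 * Num.sqrt 3 :> R.
    by rewrite -sqrtrM // -natrM.
  transitivity
    (Num.sqrt 2 ^+ 2 * (Num.sqrt 3 ^+ 2 + 2 * Num.sqrt 3 + 1) / 4 : R).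
    by field.
  by rewrite s2 s3; field.
lra.
Qed.
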